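(* Let $\emptyset\neq\mathcal{Y}\subseteq\mathbb{R}^n$ be open, $u\in\mathcal{Y}$, and let $\mathbf{\Phi}:\mathcal{Y}\to I(\mathbb{R})$ be $gH$-Fréchet differentiable at $u$. If $u$ is a weak efficient point of $\mathbf{\Phi}$, then for every $y\in\mathcal{Y}$, $$\sup\left\{\widehat{\mathbf{G}}^\top\odot(y-u)\ominus_{gH}c\|y-u\|:(\widehat{\mathbf{G}},c)\in\partial^w\mathbf{\Phi}(u)\right\}=\mathbf{0}.$$
   Context: $I(\mathbb{R})$ is the set of compact intervals $\mathbf{X}=[\underline{x},\overline{x}]$, $\underline{x}\le\overline{x}$; a real number $c$ is identified with $[c,c]$; $\mathbf{0}=[0,0]$. Operations: $\mathbf{X}\oplus\mathbf{Y}=[\underline{x}+\underline{y},\overline{x}+\overline{y}]$; $\lambda\odot\mathbf{X}=[\min\{\lambda\underline{x},\lambda\overline{x}\},\max\{\lambda\underline{x},\lambda\overline{x}\}]$ for $\lambda\in\mathbb{R}$; $gH$-difference $\mathbf{X}\ominus_{gH}\mathbf{Y}=[\min\{\underline{x}-\underline{y},\overline{x}-\overline{y}\},\max\{\underline{x}-\underline{y},\overline{x}-\overline{y}\}]$, read from left to right when iterated. Order: $\mathbf{X}\preceq\mathbf{Y}$ iff $\underline{x}\le\underline{y}$ and $\overline{x}\le\overline{y}$. The supremum of a set of intervals is the least upper bound for $\preceq$; explicitly $\sup_\mu[a_\mu,b_\mu]=[\sup_\mu a_\mu,\sup_\mu b_\mu]$. Norm: $\|\mathbf{X}\|_{I(\mathbb{R})}=\max\{|\underline{x}|,|\overline{x}|\}$.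 For $\widehat{\mathbf{G}}=(\mathbf{G}_1,\dots,\mathbf{G}_n)\in I(\mathbb{R})^n$ and $d\in\mathbb{R}^n$, $\widehat{\mathbf{G}}^\top\odot d=\bigoplus_{i=1}^n d_i\odot\mathbf{G}_i$. $\mathbb{R}_+=[0,\infty)$ and $\|\cdot\|$ is the Euclidean norm. The $gH$-weak subdifferential of $\mathbf{\Phi}$ at $u\in\mathcal{Y}$ is $$\partial^w\mathbf{\Phi}(u)=\{(\widehat{\mathbf{G}},c)\in I(\mathbb{R})^n\times\mathbb{R}_+:\ \widehat{\mathbf{G}}^\top\odot(y-u)\ominus_{gH}c\|y-u\|\preceq\mathbf{\Phi}(y)\ominus_{gH}\mathbf{\Phi}(u)\ \ \forall y\in\mathcal{Y}\}.$$ A point $u\in\mathcal{Y}$ is a weak efficient point of $\mathbf{\Phi}$ if $\mathbf{\Phi}(u)\preceq\mathbf{\Phi}(y)$ for all $y\in\mathcal{Y}$. $\mathbf{\Phi}$ (on a nonempty open set $\mathcal{Y}$) is $gH$-Fréchet differentiable at $u$ if there is a $gH$-continuous linear interval-valued map $\mathbf{G}$, identified with an interval vector $\widehat{\mathbf{G}}\in I(\mathbb{R})^n$ via $\mathbf{G}(h)=\widehat{\mathbf{G}}^\top\odot h$, such that $\lim_{\|h\|\to0}\frac{1}{\|h\|}\|\mathbf{\Phi}(u+h)\ominus_{gH}\mathbf{\Phi}(u)\ominus_{gH}\mathbf{G}(h)\|_{I(\mathbb{R})}=0$. *)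

(* Defs.v *)
(* MathComp-Analysis, over an arbitrary [R : realType]. *)
From HB Require Import structures.
From mathcomp Require Import all_boot all_order all_algebra.
From mathcomp Require Import all_classical all_reals all_analysis.

Set Implicit Arguments.
Unset Strict Implicit.
Unset Printing Implicit Defensive.

Import Order.TTheory GRing.Theory Num.Theory numFieldNormedType.Exports.

Local Open Scope classical_set_scope.
Local Open Scope ring_scope.

(* Compact intervals [lo X, hi X] with lo X <= hi X. *)
Record cinterval (R : realType) :=
  CInterval { bounds : R * R; boundsP : bounds.1 <= bounds.2 }.

HB.instance Definition _ (R : realType) := [isSub for @bounds R].
HB.instance Definition _ (R : realType) := [Choice of cinterval R by <:].

Section Intervals.
Variable R : realType.
Implicit Types (X Y Z : cinterval R) (a b c : R).

Definition lo X : R := (bounds X).1.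
Definition hi X : R := (bounds X).2.

Lemma lo_le_hi X : lo X <= hi X. Proof. exact: boundsP. Qed.

Definition icst c : cinterval R := @CInterval R (c, c) (lexx c).

Lemma iadd_subproof X Y : (lo X + lo Y, hi X + hi Y).1 <= (lo X + lo Y, hi X + hi Y).2.
Proof. by rewrite lerD ?lo_le_hi. Qed.

Definition iadd X Y : cinterval R := CInterval (iadd_subproof X Y).

Lemma min_le_max_subproof a b : (Num.min a b, Num.max a b).1 <= (Num.min a b, Num.max a b).2.
Proof. by rewrite /= ge_min le_max lexx. Qed.

Definition ihull a b : cinterval R := CInterval (min_le_max_subproof a b).

Definition iscale a X : cinterval R := ihull (a * lo X) (a * hi X).

Definition gHsub X Y : cinterval R := ihull (lo X - lo Y) (hi X - hi Y).

Definition inorm X : R := Num.max `|lo X| `|hi X|.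

Definition cinterval_le X Y := (lo X <= lo Y) && (hi X <= hi Y).

Lemma cinterval_le_refl : reflexive cinterval_le.
Proof. by move=> X; rewrite /cinterval_le !lexx. Qed.

Lemma cinterval_le_anti : antisymmetric cinterval_le.
Proof.
move=> X Y /andP[/andP[lXY hXY] /andP[lYX hYX]]; apply: val_inj => /=.
have el : lo X = lo Y by apply/le_anti; rewrite lXY lYX.
have eh : hi X = hi Y by apply/le_anti; rewrite hXY hYX.
by rewrite [LHS]surjective_pairing [RHS]surjective_pairing; congr pair.
Qed.

Lemma cinterval_le_trans : transitive cinterval_le.
Proof.
move=> Y X Z /andP[lXY hXY] /andP[lYZ hYZ].
by rewrite /cinterval_le (le_trans lXY lYZ) (le_trans hXY hYZ).
Qed.

End Intervals.

(* [(X <= Y)%O] on intervals is [cinterval_le X Y]; the supremum of a set of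
   intervals is then taken with the library's [isLub]. *)
Fact cinterval_display : Order.disp_t. Proof. exact: Order.Disp tt tt. Qed.

HB.instance Definition _ (R : realType) :=
  Order.Le_isPOrder.Build cinterval_display (cinterval R)
    (@cinterval_le_refl R) (@cinterval_le_anti R) (@cinterval_le_trans R).

Section GHCalculus.
Variables (R : realType) (n : nat).
Implicit Types (Y : set 'rV[R]_n) (Phi G : 'rV[R]_n -> cinterval R).
Implicit Types (u d : 'rV[R]_n) (Ghat : 'rV[cinterval R]_n).

(* The library norm on ['rV[R]_n] is the sup norm; it has the same topology. *)
Definition enorm d : R := Num.sqrt (\sum_(i < n) d 0 i ^+ 2).

Definition idot Ghat d : cinterval R :=
  \big[@iadd R/icst 0]_(i < n) iscale (d 0 i) (Ghat 0 i).

(* A map [Phi] on [Y] is a total function of which only the values on [Y] are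
   ever used. *)

Definition gH_weak_subdiff Y Phi u : set ('rV[cinterval R]_n * R) :=
  [set p | 0 <= p.2 /\
     forall y, Y y ->
       (gHsub (idot p.1 (y - u)) (icst (p.2 * enorm (y - u)))
          <= gHsub (Phi y) (Phi u))%O].

Definition weak_efficient Y Phi u :=
  Y u /\ forall y, Y y -> (Phi u <= Phi y)%O.

Definition gH_continuous G :=
  forall x : 'rV[R]_n, inorm (gHsub (G (x + h)) (G x)) @[h --> (0 : 'rV[R]_n)] --> (0 : R).

(* Linear interval-valued maps are those given by an interval vector; they are
   automatically gH-continuous. *)
Definition interval_linear G := exists Ghat, forall h, G h = idot Ghat h.

Definition gH_frechet_differentiable Y Phi u :=
  exists G, [/\ gH_continuous G, interval_linear G &
    (enorm h)^-1 * inorm (gHsub (gHsub (Phi (u + h)) (Phi u)) (G h))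
      @[h --> within [set h | Y (u + h)] (0 : 'rV[R]_n)^'] --> (0 : R)].

End GHCalculus.

(* Main.v *)
(** Along a ray [u + t d], [t > 0], both endpoints of [Phi (u + t d) - Phi u] are
    nonnegative and differ from those of [t G(d)] by [o(t)], so [lo (G d) >= 0] for
    every direction [d].  Since [lo (G (- d)) = - hi (G d)], the derivative [G]
    vanishes.  A weak subgradient [(Ghat, c)] gives an interval positively homogeneous
    in [d] and bounded above by [Phi (u + t d) - Phi u = o(t)], hence it is [<= 0];
    the bound is attained at [(0, 0)]. *)
Require Import Defs.
From HB Require Import structures.
From mathcomp Require Import all_boot all_order all_algebra.
From mathcomp Require Import all_classical all_reals all_analysis.
From mathcomp Require Import ring lra.

Set Implicit Arguments.
Unset Strict Implicit.
Unset Printing Implicit Defensive.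

Import Order.TTheory GRing.Theory Num.Theory numFieldNormedType.Exports.

Local Open Scope classical_set_scope.
Local Open Scope ring_scope.

Section IntervalCalculus.
Variable R : realType.
Implicit Types (X Z : cinterval R) (a t : R).

Lemma cinterval_leE X Z : (X <= Z)%O = (lo X <= lo Z) && (hi X <= hi Z).
Proof. by []. Qed.

Lemma cinterval_eq X Z : lo X = lo Z -> hi X = hi Z -> X = Z.
Proof. by move=> lE hE; apply: le_anti; rewrite !cinterval_leE lE hE !lexx. Qed.

(** The hull may swap the two endpoint differences, but a maximum of absolute values does not see
    their order. *)
Lemma inorm_gHsub X Z :
  inorm (gHsub X Z) = Num.max `|lo X - lo Z| `|hi X - hi Z|.
Proof.
rewrite /inorm {1}/lo {1}/hi /=.
by case: (leP (lo X - lo Z)) => // _; rewrite maxC.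
Qed.

Lemma lo_gHsub_ge0 X Z : (Z <= X)%O -> 0 <= lo (gHsub X Z).
Proof. by case/andP=> lZX hZX; rewrite /lo /= le_min !subr_ge0 lZX. Qed.

Lemma lo_gHsub_icst X a : lo (gHsub X (icst a)) = lo X - a.
Proof. by rewrite [LHS]/lo /= min_l // lerB ?lo_le_hi. Qed.

Lemma hi_gHsub_icst X a : hi (gHsub X (icst a)) = hi X - a.
Proof. by rewrite [LHS]/hi /= max_r // lerB ?lo_le_hi. Qed.

Variable n : nat.
Implicit Types (G : 'rV[cinterval R]_n) (d : 'rV[R]_n).

Lemma lo_idot G d :
  lo (idot G d) = \sum_(i < n) Num.min (d 0 i * lo (G 0 i)) (d 0 i * hi (G 0 i)).
Proof. exact: (big_morph (@lo R)). Qed.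

Lemma hi_idot G d :
  hi (idot G d) = \sum_(i < n) Num.max (d 0 i * lo (G 0 i)) (d 0 i * hi (G 0 i)).
Proof. exact: (big_morph (@hi R)). Qed.

Lemma lo_idotZ G d t : 0 <= t -> lo (idot G (t *: d)) = t * lo (idot G d).
Proof.
move=> t0; rewrite !lo_idot mulr_sumr; apply: eq_bigr => i _.
by rewrite mxE minr_pMr // !mulrA.
Qed.

Lemma hi_idotZ G d t : 0 <= t -> hi (idot G (t *: d)) = t * hi (idot G d).
Proof.
move=> t0; rewrite !hi_idot mulr_sumr; apply: eq_bigr => i _.
by rewrite mxE maxr_pMr // !mulrA.
Qed.

(** Flipping the sign of a coordinate exchanges the min and the max in its summand. This turns lower
    bounds valid in all directions into upper bounds. *)
Lemma lo_idotN G d : lo (idot G (- d)) = - hi (idot G d).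
Proof.
rewrite lo_idot hi_idot -sumrN; apply: eq_bigr => i _.
by rewrite mxE !mulNr oppr_max.
Qed.

Lemma idot_icst0 d : idot (const_mx (icst 0)) d = icst 0.
Proof.
by apply: cinterval_eq; rewrite ?lo_idot ?hi_idot big1 // => i _;
  rewrite mxE /lo /hi /= mulr0 ?minxx ?maxxx.
Qed.

Lemma enormZ d t : 0 <= t -> enorm (t *: d) = t * enorm d.
Proof.
move=> t0; rewrite /enorm -[t in RHS](ger0_norm t0) -sqrtr_sqr -sqrtrM ?sqr_ge0//.
by rewrite mulr_sumr; congr Num.sqrt; apply: eq_bigr => i _; rewrite mxE exprMn.
Qed.

Lemma enorm_gt0 d : d != 0 -> 0 < enorm d.
Proof.
move=> d0; rewrite sqrtr_gt0 lt_def sumr_ge0 ?andbT => [|i _]; last exact: sqr_ge0.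
apply: contra d0; rewrite psumr_eq0 => [/allP dE|i _]; last exact: sqr_ge0.
apply/eqP/rowP => i; rewrite mxE; apply/eqP.
by rewrite -sqrf_eq0; apply: dE; rewrite mem_index_enum.
Qed.

End IntervalCalculus.

Section RayLimits.
Variables (R : realType) (n : nat) (Y : set 'rV[R]_n) (u : 'rV[R]_n).

Lemma littleo_ray (F : 'rV[R]_n -> R) (d : 'rV[R]_n) (e : R) :
  open Y -> Y u -> d != 0 -> 0 < e ->
  (enorm h)^-1 * F h @[h --> within [set h | Y (u + h)] (0 : 'rV[R]_n)^'] --> (0 : R) ->
  exists t, [/\ 0 < t, Y (u + t *: d) & F (t *: d) <= e * t].
Proof.
move=> Yo Yu d0 e0 F0.
have nd := enorm_gt0 d0.
(* Since [enorm (t *: d) = t * enorm d], this tolerance on the quotient becomes exactly [e * t]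
   after clearing the denominator. *)
have e'0 : 0 < e / enorm d by rewrite divr_gt0.
have td0 : t *: d @[t --> (0 : R)] --> (0 : 'rV[R]_n).
  by rewrite -[X in _ --> X](scale0r d); apply: cvgZr_tmp; exact: cvg_id.
have Ytd : \forall t \near (0 : R), Y (u + t *: d).
  have : u + t *: d @[t --> (0 : R)] --> u.
    by rewrite -[X in _ --> X]addr0; apply: cvgD => //; exact: cvg_cst.
  by move=> /(_ Y); apply; exact: open_nbhs_nbhs.
have Ftd : \forall t \near (0 : R), t *: d != 0 -> Y (u + t *: d) ->
    `|(enorm (t *: d))^-1 * F (t *: d)| < e / enorm d.
  exact: td0 (cvgr0_norm_lt _ F0 _ e'0).
have [t [Yt Ft t0]] : exists t : R, [/\ Y (u + t *: d),
    t *: d != 0 -> Y (u + t *: d) ->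
      `|(enorm (t *: d))^-1 * F (t *: d)| < e / enorm d & 0 < t].
  (* Both properties hold on a two-sided ball around 0; its point [r / 2] supplies a positive
     [t]. *)
  have [r /= r0 rP] := (nbhs_ballP _ _).1 (filterI Ytd Ftd).
  have [] := rP (r / 2); last by exists (r / 2); split; rewrite ?divr_gt0.
  by rewrite /ball /= sub0r normrN gtr0_norm ?divr_gt0 // ltr_pdivrMr //; lra.
exists t; split => //.
have td_neq0 : t *: d != 0 by rewrite scaler_eq0 negb_or d0 gt_eqF.
have := ltW (le_lt_trans (ler_norm _) (Ft td_neq0 Yt)).
rewrite (enormZ _ (ltW t0)) ler_pdivrMl ?mulr_gt0 // => /le_trans; apply.
by rewrite le_eqVlt; apply/orP; left; apply/eqP; field; rewrite gt_eqF.
Qed.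

Variable Phi : 'rV[R]_n -> cinterval R.
Hypotheses (Yo : open Y) (Phi_diff : gH_frechet_differentiable Y Phi u).
Hypothesis u_eff : weak_efficient Y Phi u.

Lemma increment_ray (d : 'rV[R]_n) (e : R) : d != 0 -> 0 < e ->
  exists t, [/\ 0 < t, Y (u + t *: d) &
    hi (gHsub (Phi (u + t *: d)) (Phi u)) <= e * t].
Proof.
have [Yu umin] := u_eff; have [G [_ [Ghat GE] Gdiff]] := Phi_diff.
(* The norm is a maximum over the endpoints, so a single [t] serves both estimates. *)
have ray v r : v != 0 -> 0 < r -> exists t, [/\ 0 < t, Y (u + t *: v),
    `|lo (gHsub (Phi (u + t *: v)) (Phi u)) - t * lo (idot Ghat v)| <= r * t &
    `|hi (gHsub (Phi (u + t *: v)) (Phi u)) - t * hi (idot Ghat v)| <= r * t].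
  move=> v0 r0; have [t [t0 Yt]] := littleo_ray Yo Yu v0 r0 Gdiff.
  rewrite inorm_gHsub GE (lo_idotZ _ _ (ltW t0)) (hi_idotZ _ _ (ltW t0)) ge_max => /andP[? ?].
  by exists t.
(* Efficiency makes the increment nonnegative, so [t * lo (idot Ghat v) >= - r * t]; divide by [t]
   and let [r] tend to 0. *)
have lo_ge0 v : v != 0 -> 0 <= lo (idot Ghat v).
  move=> v0; apply/ler_addgt0Pr => r r0.
  have [t [t0 Yt + _]] := ray v r v0 r0.
  have D0 := lo_gHsub_ge0 (umin _ Yt).
  rewrite ler_norml -(pmulr_rge0 _ t0) => /andP[_]; lra.
move=> d0 e0; have [t [t0 Yt _]] := ray d e d0 e0.
have : hi (idot Ghat d) <= 0 by rewrite -oppr_ge0 -lo_idotN lo_ge0 ?oppr_eq0.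
rewrite -(pmulr_rle0 _ t0) ler_norml => G0 /andP[_ D0].
by exists t; split => //; lra.
Qed.

(** The left side is positively homogeneous in [d]: at [u + t *: d] the subgradient inequality
    bounds [t] times it by [e * t], and [e] is arbitrary. *)
Lemma weak_subgradient_le0 (p : 'rV[cinterval R]_n * R) (d : 'rV[R]_n) :
  gH_weak_subdiff Y Phi u p -> hi (idot p.1 d) - p.2 * enorm d <= 0.
Proof.
move=> [_ pP]; have [->|d0] := eqVneq d 0.
  by rewrite -(scale0r d) hi_idotZ // enormZ // !mul0r mulr0 subrr.
apply/ler_addgt0Pr => e e0; rewrite add0r.
have [t [t0 Yt D0]] := increment_ray d0 e0.
have /andP[_] := pP _ Yt.
rewrite [u + _]addrC addrK hi_gHsub_icst (hi_idotZ _ _ (ltW t0)) (enormZ _ (ltW t0)).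
rewrite [t *: d + u]addrC mulrCA -mulrBr => /le_trans/(_ D0).
by rewrite [e * t]mulrC ler_pM2l.
Qed.

Lemma zero_weak_subgradient : gH_weak_subdiff Y Phi u (const_mx (icst 0), 0).
Proof.
split=> [//|y Yy] /=; rewrite idot_icst0 mul0r.
have lo0 := lo_gHsub_ge0 (u_eff.2 _ Yy).
rewrite cinterval_leE lo_gHsub_icst hi_gHsub_icst subrr lo0.
exact: le_trans lo0 (lo_le_hi _).
Qed.

End RayLimits.

Theorem theorem10 (R : realType) (n : nat) (Y : set 'rV[R]_n) (u : 'rV[R]_n)
    (Phi : 'rV[R]_n -> cinterval R)
    (Y_nonempty : Y !=set0) (Y_open : open Y) (Yu : Y u)
    (Phi_diff : gH_frechet_differentiable Y Phi u)
    (u_eff : weak_efficient Y Phi u) :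
  forall y : 'rV[R]_n, Y y ->
    isLub [set gHsub (idot p.1 (y - u)) (icst (p.2 * enorm (y - u)))
          | p in gH_weak_subdiff Y Phi u]
      (icst 0 : cinterval R).
Proof.
move=> y Yy; split=> [_ [p /weak_subgradient_le0 p_le0 <-]|X X_ub].
  (* An upper endpoint below 0 forces the lower one below 0, so bounding [hi] is enough. *)
  have hi_le0 := p_le0 Y_open Phi_diff u_eff (y - u).
  rewrite -hi_gHsub_icst in hi_le0.
  by rewrite cinterval_leE (le_trans (lo_le_hi _) hi_le0).
(* The zero interval is itself a member of the set, hence lies below every upper bound. *)
apply: X_ub; exists (const_mx (icst 0), 0); first exact: zero_weak_subgradient.
by rewrite /= idot_icst0 mul0r; apply: cinterval_eq;
  rewrite ?lo_gHsub_icst ?hi_gHsub_icst subrr.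
Qed.
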